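(* Let $\mu=0$. The hanging equilibrium $(\Gamma_h,0)=\left(\frac{\rho}{\|\rho\|},0\right)\in TS^2$ of the Lagrange--Routh reduced dynamics of the 3D pendulum described by $$\ddot\Gamma=-\|\dot\Gamma\|^2\Gamma+\Gamma\times\Sigma$$ on $TS^2$ is stable in the sense of Lyapunov.
   Context: $J$ is the symmetric positive definite inertia matrix of the rigid body (body frame, origin at the pivot), $m,g>0$, $\rho\in\mathbb{R}^3$, $\rho\neq0$, is the body-fixed vector from the pivot to the center of mass, $\Gamma\in S^2$ is the gravity direction in the body frame, $\mu\in\mathbb{R}$ is the value of the momentum map (vertical component of angular momentum), and $$\Sigma=b\dot\Gamma+J^{-1}\Big[\big(J(\dot\Gamma\times\Gamma)-bJ\Gamma\big)\times\big((\dot\Gamma\times\Gamma)-b\Gamma\big)+\nu^2J\Gamma\times\Gamma-mg\,\Gamma\times\rho-c\,\dot\Gamma\Big],$$ $$c=\nu\Big\{\mathrm{tr}[J]-2\tfrac{\|J\Gamma\|^2}{\Gamma\cdot J\Gamma}\Big\},\quad b=\frac{J\Gamma\cdot(\dot\Gamma\times\Gamma)}{\Gamma\cdot J\Gamma},\quad \nu=\frac{\mu}{\Gamma\cdot J\Gamma}.$$ *)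

(* Defs.v *)
From mathcomp Require Import all_boot all_order all_algebra.
From mathcomp Require Import all_classical all_reals all_analysis.

Set Implicit Arguments.
Unset Strict Implicit.
Unset Printing Implicit Defensive.

Import Order.TTheory GRing.Theory Num.Theory.
Import numFieldNormedType.Exports.

Local Open Scope classical_set_scope.
Local Open Scope ring_scope.

Section Euclidean3.
Variable R : realType.
Implicit Types u v : 'cV[R]_3.

Definition dotp u v : R := \sum_(i < 3) u i 0 * v i 0.

(* The library norm `|u| on column vectors is the sup norm, so the Euclidean
   norm is defined separately. *)
Definition enorm u : R := Num.sqrt (dotp u u).

(* Indices are read modulo 3, so that row i is
   u_(i+1) v_(i+2) - u_(i+2) v_(i+1). *)
Definition crossp u v : 'cV[R]_3 :=
  \col_(i < 3) (u (i + 1) 0 * v (i + 2%:R) 0 - u (i + 2%:R) 0 * v (i + 1) 0).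

Definition sym_posdef (A : 'M[R]_3) : Prop :=
  A^T = A /\ forall u, u != 0 -> 0 < dotp u (A *m u).

Definition sphere2 : set 'cV[R]_3 := [set u | enorm u = 1].

Definition tangent_sphere2 : set ('cV[R]_3 * 'cV[R]_3) :=
  [set x | sphere2 x.1 /\ dotp x.1 x.2 = 0].

End Euclidean3.

Section AutonomousODE.
Variables (R : realType) (V : normedModType R).
Variables (M : set V) (F : V -> V).

(* The phase space M is a subset of the ambient space V, and F is a vector
   field on V.  At the initial time only continuity (from the right) is
   required; values of x outside [0, T) are irrelevant. *)
Definition is_solution (T : \bar R) (x : R -> V) : Prop :=
  [/\ {within [set t : R | 0 <= t /\ (t%:E < T)%E], continuous x},
      (forall t : R, 0 <= t -> (t%:E < T)%E -> M (x t)) &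
      (forall t : R, 0 < t -> (t%:E < T)%E -> is_derive t (1 : R) x (F (x t)))].

Definition is_equilibrium (x0 : V) : Prop := M x0 /\ F x0 = 0.

(* All solutions are considered, T being finite or +oo, so that solutions
   are not assumed to exist for all time. *)
Definition lyapunov_stable (x0 : V) : Prop :=
  is_equilibrium x0 /\
  forall eps : R, 0 < eps -> exists2 delta : R, 0 < delta &
    forall (T : \bar R) (x : R -> V), (0 < T)%E -> is_solution T x ->
      `|x 0 - x0| < delta ->
      forall t : R, 0 <= t -> (t%:E < T)%E -> `|x t - x0| < eps.

End AutonomousODE.

(* J: inertia matrix in the body frame; m, g: mass and gravity; rho: body-fixed
   vector from the pivot to the center of mass; mu: vertical component of the
   angular momentum; G: gravity direction in the body frame. *)
Section LagrangeRouth.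
Variables (R : realType) (J : 'M[R]_3) (m g : R) (rho : 'cV[R]_3) (mu : R).
Implicit Types G dG : 'cV[R]_3.

Definition lr_nu G : R := mu / dotp G (J *m G).

Definition lr_b G dG : R :=
  dotp (J *m G) (crossp dG G) / dotp G (J *m G).

Definition lr_c G : R :=
  lr_nu G * (\tr J - 2 * (enorm (J *m G) ^+ 2 / dotp G (J *m G))).

Definition lr_Sigma G dG : 'cV[R]_3 :=
  lr_b G dG *: dG +
  invmx J *m
    (crossp (J *m crossp dG G - lr_b G dG *: (J *m G))
            (crossp dG G - lr_b G dG *: G)
     + lr_nu G ^+ 2 *: crossp (J *m G) G
     - (m * g) *: crossp G rho
     - lr_c G *: dG).

(* The second-order equation G'' = - |G'|^2 G + G x Sigma(G, G'), as a
   first-order system in the state (G, G'). *)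
Definition lr_field (x : 'cV[R]_3 * 'cV[R]_3) : 'cV[R]_3 * 'cV[R]_3 :=
  (x.2, - (enorm x.2 ^+ 2) *: x.1 + crossp x.1 (lr_Sigma x.1 x.2)).

End LagrangeRouth.

(* Main.v *)
Require Import Defs.
From mathcomp Require Import all_boot all_order all_algebra ring lra.
From mathcomp Require Import all_classical all_reals all_analysis.
Import Order.TTheory GRing.Theory Num.Theory.
Import numFieldNormedType.Exports.
Local Open Scope classical_set_scope.
Local Open Scope ring_scope.

(* Put w = G' x G - b G, so that G' = G x w and G . J w = 0.  Along solutions
   w obeys Euler's equation, and the energy E = w . J w / 2 - m g rho . G is
   conserved.  With e = rho / |rho|, on the tangent bundle of the sphere
     E + m g |rho| = w . J w / 2 + (m g |rho| / 2) |G - e|^2,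
   which is bounded below by a multiple of |G - e|^2 + |G'|^2, since J is
   positive definite and |G'| <= |w|, and above by another such multiple, since
   removing the J-projection on G only decreases the kinetic energy of G' x G.
   Hence every coordinate of the deviation from (e, 0) at time t is at most a
   constant times the initial deviation. *)

Set Implicit Arguments.
Unset Strict Implicit.
Unset Printing Implicit Defensive.

(** * Coordinates, products and quadratic forms in dimension three *)

Lemma sum_ord3 (V : nmodType) (F : 'I_3 -> V) :
  \sum_(i < 3) F i = F 0 + F 1 + F 2%:R.
Proof.
rewrite !big_ord_recl big_ord0 addr0 addrA.
by congr (F _ + F _ + F _); apply: val_inj.
Qed.

Lemma ord3_ind (P : 'I_3 -> Prop) : P 0 -> P 1 -> P 2%:R -> forall i, P i.
Proof.
move=> P0 P1 P2 [[|[|[|//]]] lti3].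
- by rewrite (_ : Ordinal _ = 0) //; apply: val_inj.
- by rewrite (_ : Ordinal _ = 1) //; apply: val_inj.
- by rewrite (_ : Ordinal _ = 2%:R) //; apply: val_inj.
Qed.

Section VectorAlgebra.
Variable R : realType.
Implicit Types (a : R) (u v w z : 'cV[R]_3) (A : 'M[R]_3).

Lemma colvec3P u v :
  u 0 0 = v 0 0 -> u 1 0 = v 1 0 -> u 2%:R 0 = v 2%:R 0 -> u = v.
Proof. by move=> *; apply/colP; elim/ord3_ind. Qed.

Lemma dotpE u v :
  dotp u v = u 0 0 * v 0 0 + u 1 0 * v 1 0 + u 2%:R 0 * v 2%:R 0.
Proof. exact: sum_ord3. Qed.

Lemma crosspE u v :
  (crossp u v 0 0 = u 1 0 * v 2%:R 0 - u 2%:R 0 * v 1 0) *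
  (crossp u v 1 0 = u 2%:R 0 * v 0 0 - u 0 0 * v 2%:R 0) *
  (crossp u v 2%:R 0 = u 0 0 * v 1 0 - u 1 0 * v 0 0).
Proof.
have e11 : 1 + 1 = 2%:R :> 'I_3 by apply: val_inj.
have e12 : 1 + 2%:R = 0 :> 'I_3 by apply: val_inj.
have e21 : 2%:R + 1 = 0 :> 'I_3 by apply: val_inj.
have e22 : 2%:R + 2%:R = 1 :> 'I_3 by apply: val_inj.
by rewrite /crossp !mxE !add0r e11 e12 e21 e22.
Qed.

Lemma dotpC u v : dotp u v = dotp v u.
Proof. by rewrite !dotpE; ring. Qed.

Lemma dotpDr u v w : dotp u (v + w) = dotp u v + dotp u w.
Proof. by rewrite !dotpE !mxE; ring. Qed.

Lemma dotpBr u v w : dotp u (v - w) = dotp u v - dotp u w.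
Proof. by rewrite !dotpE !mxE; ring. Qed.

Lemma dotpZr a u v : dotp u (a *: v) = a * dotp u v.
Proof. by rewrite !dotpE !mxE; ring. Qed.

Lemma dotpNr u v : dotp u (- v) = - dotp u v.
Proof. by rewrite -scaleN1r dotpZr mulN1r. Qed.

Lemma dotpBl u v w : dotp (u - v) w = dotp u w - dotp v w.
Proof. by rewrite !dotpE !mxE; ring. Qed.

Lemma dotpZl a u v : dotp (a *: u) v = a * dotp u v.
Proof. by rewrite !dotpE !mxE; ring. Qed.

Lemma dotp_ge0 u : 0 <= dotp u u.
Proof. by rewrite dotpE !addr_ge0 // -expr2 sqr_ge0. Qed.

Lemma sqr_coord_le_dotp u i : u i 0 ^+ 2 <= dotp u u.
Proof.
move: i; elim/ord3_ind; rewrite dotpE -!expr2.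
- by rewrite -addrA lerDl addr_ge0 // sqr_ge0.
- by rewrite addrAC lerDr addr_ge0 // sqr_ge0.
- by rewrite lerDr addr_ge0 // sqr_ge0.
Qed.

Lemma dotp_eq0 u : (dotp u u == 0) = (u == 0).
Proof.
apply/eqP/eqP => [u0|->]; last by rewrite dotpE !mxE; ring.
apply/colP => i; rewrite mxE; apply/eqP; rewrite -sqrf_eq0 eq_le sqr_ge0 andbT.
by rewrite -u0 sqr_coord_le_dotp.
Qed.

Lemma dotp_mulmx_sym A u v : A^T = A -> dotp u (A *m v) = dotp (A *m u) v.
Proof.
move=> sA; have Aji i j : A i j = A j i by rewrite -{1}sA mxE.
rewrite !dotpE !mxE !sum_ord3 (Aji 1 0) (Aji 2%:R 0) (Aji 2%:R 1); ring.
Qed.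

Lemma dotp_crossp_rot u v w : dotp u (crossp v w) = dotp v (crossp w u).
Proof. by rewrite !dotpE !crosspE; ring. Qed.

Lemma crossp_anti u v : crossp u v = - crossp v u.
Proof. by apply: colvec3P; rewrite [RHS]mxE !crosspE; ring. Qed.

Lemma crossp_id u : crossp u u = 0.
Proof. by apply: colvec3P; rewrite crosspE mxE; ring. Qed.

Lemma crosspZr a u v : crossp u (a *: v) = a *: crossp u v.
Proof. by apply: colvec3P; rewrite [RHS]mxE !crosspE !mxE; ring. Qed.

Lemma crosspZl a u v : crossp (a *: u) v = a *: crossp u v.
Proof. by apply: colvec3P; rewrite [RHS]mxE !crosspE !mxE; ring. Qed.

Lemma crosspDl u v w : crossp (u + v) w = crossp u w + crossp v w.
Proof. by apply: colvec3P; rewrite [RHS]mxE !crosspE !mxE; ring. Qed.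

Lemma crosspBr u v w : crossp u (v - w) = crossp u v - crossp u w.
Proof.
by apply: colvec3P; rewrite [RHS]mxE [(- crossp u w) _ _]mxE !crosspE !mxE;
  ring.
Qed.

Lemma double_crossp u v w :
  crossp (crossp u v) w = dotp u w *: v - dotp v w *: u.
Proof. by apply: colvec3P; rewrite !crosspE !mxE !dotpE; ring. Qed.

Lemma lagrange_crossp u v :
  dotp (crossp u v) (crossp u v) = dotp u u * dotp v v - dotp u v ^+ 2.
Proof. by rewrite !dotpE !crosspE; ring. Qed.

(** The quadratic form would vanish at a nonzero kernel vector. [det0P] provides that vector as a
    row, hence the transposes. *)
Lemma posdef_unitmx A : sym_posdef A -> A \in unitmx.
Proof.
move=> [sA pA]; rewrite unitmxE unitfE; apply/negP => /det0P[v v0 vA].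
have vT0 : v^T != 0 by apply: contra_neq v0 => vT; rewrite -[v]trmxK vT trmx0.
have := pA _ vT0; rewrite -[A]sA -trmx_mul vA trmx0.
by rewrite dotpE !mxE !mulr0 !addr0 ltxx.
Qed.

Lemma posdef_ge0 A u : sym_posdef A -> 0 <= dotp u (A *m u).
Proof.
move=> [_ pA]; have [->|u0] := eqVneq u 0; last exact/ltW/pA.
by rewrite mulmx0 dotpE !mxE; lra.
Qed.

(** The form is nonnegative at [u] minus its [A]-orthogonal projection on [v]. *)
Lemma posdef_cauchy_schwarz A u v : sym_posdef A ->
  dotp u (A *m v) ^+ 2 <= dotp u (A *m u) * dotp v (A *m v).
Proof.
move=> hA; have [sA pA] := hA; have [->|v0] := eqVneq v 0.
  by rewrite mulmx0 !dotpE !mxE; lra.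
have vp := pA _ v0; have vne := lt0r_neq0 vp.
have := posdef_ge0 (u - (dotp u (A *m v) / dotp v (A *m v)) *: v) hA.
rewrite mulmxBr -scalemxAr !dotpBr !dotpBl !dotpZr !dotpZl.
rewrite (dotpC v (A *m u)) -(dotp_mulmx_sym _ _ sA).
move: (dotp u (A *m u)) (dotp u (A *m v)) (dotp v (A *m v)) vp vne
  => p q r rp r0 h.
have -> : q ^+ 2 = (q / r) ^+ 2 * r * r by field.
apply: ler_wpM2r; first exact: ltW.
rewrite -subr_ge0; apply: le_trans h _.
by rewrite le_eqVlt; apply/orP; left; apply/eqP; field.
Qed.

(** With [w i] the preimage under [A] of the i-th basis vector, [u i 0] is the [A]-inner product of
    [u] and [w i], so Cauchy-Schwarz applies. Summing over [i] makes the constant uniform, without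
    eigenvalues or compactness. *)
Lemma posdef_coord_bound A : sym_posdef A ->
  exists2 C : R, 0 < C & forall u i, u i 0 ^+ 2 <= C * dotp u (A *m u).
Proof.
move=> hA; have [sA _] := hA.
pose w i : 'cV[R]_3 := invmx A *m delta_mx i 0.
exists (1 + \sum_i dotp (w i) (A *m w i)).
  by rewrite ltr_pwDl // sumr_ge0 // => i _; exact: posdef_ge0.
move=> u i.
have -> : u i 0 = dotp u (A *m w i).
  rewrite mulmxA mulmxV ?posdef_unitmx // mul1mx /dotp (bigD1 i) //= mxE !eqxx.
  rewrite mulr1 big1 ?addr0 // => j /negPf ji.
  by rewrite mxE ji mulr0.
apply: le_trans (posdef_cauchy_schwarz _ _ hA) _.
rewrite mulrC ler_wpM2r ?posdef_ge0 // (bigD1 i) //= addrCA lerDl.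
by rewrite addr_ge0 // sumr_ge0 // => j _; exact: posdef_ge0.
Qed.

Lemma quad_form_bound A :
  exists2 S : R, 0 < S & forall u d, (forall i, `|u i 0| <= d) ->
    dotp u (A *m u) <= S * d ^+ 2.
Proof.
exists (1 + \sum_i \sum_j `|A i j|).
  by rewrite ltr_pwDl // sumr_ge0 // => i _; rewrite sumr_ge0.
move=> u d ud; have d0 : 0 <= d := le_trans (normr_ge0 _) (ud 0).
have -> : dotp u (A *m u) = \sum_i \sum_j u i 0 * (A i j * u j 0).
  by apply: eq_bigr => i _; rewrite mxE big_distrr.
rewrite mulrDl mul1r -[leLHS]add0r lerD ?sqr_ge0 //.
rewrite big_distrl ler_sum //= => i _; rewrite big_distrl ler_sum //= => j _.
apply: le_trans (ler_norm _) _.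
by rewrite !normrM mulrCA expr2 ler_wpM2l // ler_pM.
Qed.

End VectorAlgebra.

(** * The energy: power balance and two-sided bounds near the hanging state *)

Section Energy.
Variables (R : realType) (J : 'M[R]_3) (m g : R) (rho : 'cV[R]_3).
Hypotheses (hJ : sym_posdef J) (hm : 0 < m) (hg : 0 < g) (hrho : rho != 0).
Implicit Types (G dG : 'cV[R]_3) (x : 'cV[R]_3 * 'cV[R]_3).

(* The body angular velocity on the momentum level mu = 0. *)
Definition lr_omega G dG : 'cV[R]_3 := crossp dG G - lr_b J G dG *: G.

Definition lr_energy x : R :=
  2^-1 * dotp (lr_omega x.1 x.2) (J *m lr_omega x.1 x.2)
  - m * g * dotp rho x.1.

Lemma enorm_sqr (u : 'cV[R]_3) : enorm u ^+ 2 = dotp u u.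
Proof. by rewrite sqr_sqrtr // dotp_ge0. Qed.

Lemma enorm_gt0 (u : 'cV[R]_3) : u != 0 -> 0 < enorm u.
Proof. by move=> u0; rewrite sqrtr_gt0 lt_def dotp_eq0 u0 dotp_ge0. Qed.

Lemma sphere2_dotp G : sphere2 G -> dotp G G = 1.
Proof. by rewrite /sphere2 /= -enorm_sqr => ->; rewrite expr1n. Qed.

Lemma inertia_gt0 G : dotp G G = 1 -> 0 < dotp G (J *m G).
Proof.
move=> G1; apply: (hJ.2); rewrite -dotp_eq0 G1; exact: oner_neq0.
Qed.

(** [lr_b] is the coefficient of the [J]-orthogonal projection of [crossp dG G] on [G], and
    [lr_omega] is what remains after removing it. *)
Lemma vertical_momentum0 G dG : dotp G G = 1 ->
  dotp G (J *m lr_omega G dG) = 0.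
Proof.
move=> /inertia_gt0/lt0r_neq0 q0.
rewrite mulmxBr -scalemxAr dotpBr dotpZr (dotp_mulmx_sym _ _ hJ.1).
by rewrite /lr_b divfK // subrr.
Qed.

(** The multiple of [G] in [lr_omega] is lost in the product, and G x (G' x G) = G' for a tangent
    G'. *)
Lemma crossp_omega G dG : dotp G G = 1 -> dotp G dG = 0 ->
  crossp G (lr_omega G dG) = dG.
Proof.
move=> G1 GdG; rewrite crosspBr crosspZr crossp_id scaler0 subr0.
by rewrite crossp_anti double_crossp dotpC GdG G1 scale0r scale1r sub0r opprK.
Qed.

(* The derivative b' of lr_b is left unspecified: it multiplies the vertical
   momentum, which vanishes. *)
Lemma kinetic_power G dG b' : dotp G G = 1 -> dotp G dG = 0 ->
  dotp (J *m lr_omega G dG)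
    (crossp (lr_field J m g rho 0 (G, dG)).2 G - (b' *: G + lr_b J G dG *: dG))
  = m * g * dotp rho dG.
Proof.
move=> G1 GdG; set w := lr_omega G dG; set b := lr_b J G dG.
have LG : dotp (J *m w) G = 0 by rewrite dotpC vertical_momentum0.
(* Multiples of [G] vanish against [J *m w]: this removes the [b'] term and the normal part of (G x
   Sigma) x G = Sigma - (Sigma . G) G. *)
rewrite dotpBr dotpDr !dotpZr LG mulr0 add0r /lr_field /=.
rewrite crosspDl crosspZl crossp_id scaler0 add0r double_crossp G1 scale1r.
rewrite dotpBr dotpZr LG mulr0 subr0 /lr_Sigma /lr_c /lr_nu mul0r mul0r.
rewrite expr0n scale0r scale0r addr0 subr0 -/b dotpDr dotpZr.
(* Symmetry moves [J] next to [invmx J], leaving the torques of Euler's equation paired with [w];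
   the gyroscopic torque does no work. *)
rewrite -(dotp_mulmx_sym w (invmx J *m _) hJ.1) mulKVmx ?posdef_unitmx //.
rewrite scalemxAr -mulmxBr -/(lr_omega G dG) -/w.
rewrite (dotpBr w (crossp (J *m w) w)) dotpZr.
have -> : dotp w (crossp (J *m w) w) = 0.
  by rewrite dotp_crossp_rot crossp_id dotpE !mxE; ring.
(* Two cyclic rotations give w . (G x rho) = rho . (w x G) = - rho . G'. The two terms in [b]
   cancel. *)
rewrite 2!dotp_crossp_rot crossp_anti crossp_omega // dotpNr.
ring.
Qed.

Let e := (enorm rho)^-1 *: rho.

Lemma hanging_dotp : dotp e e = 1.
Proof.
rewrite dotpZl dotpZr -enorm_sqr; field.
by rewrite lt0r_neq0 ?enorm_gt0.
Qed.

Let W x := lr_energy x + m * g * enorm rho.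

(** Two unit vectors satisfy |G - e|^2 = 2 (1 - e . G), and rho . G = |rho| (e . G). *)
Lemma energy_gapE x : dotp x.1 x.1 = 1 ->
  W x = 2^-1 * dotp (lr_omega x.1 x.2) (J *m lr_omega x.1 x.2)
        + m * g * enorm rho / 2 * dotp (x.1 - e) (x.1 - e).
Proof.
move=> x1; rewrite /W /lr_energy; move: (dotp (lr_omega _ _) _) => T.
rewrite dotpBr !dotpBl x1 hanging_dotp (dotpC x.1 e) /e dotpZl.
field; by rewrite lt0r_neq0 ?enorm_gt0.
Qed.

Lemma energy_coercive : exists2 A : R, 0 < A & forall x, tangent_sphere2 x ->
  forall i, (x.1 - e) i 0 ^+ 2 <= A * W x /\ x.2 i 0 ^+ 2 <= A * W x.
Proof.
have [C C0 HC] := posdef_coord_bound hJ.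
set k := m * g * enorm rho; have k0 : 0 < k by rewrite !mulr_gt0 ?enorm_gt0.
(* [2 / k] undoes the factor [k / 2] of the potential term. [6 * C] undoes the factor 1/2 of the
   kinetic term and counts three coordinates of [w]. *)
exists (2 / k + 6 * C); first by have := divr_gt0 (ltr0Sn R 1) k0; lra.
move=> x [/sphere2_dotp x1 x12] i.
rewrite (energy_gapE x1) -/k; clearbody k.
set w := lr_omega _ _.
have w0 : 0 <= dotp w (J *m w) := posdef_ge0 _ hJ.
have d0 := dotp_ge0 (x.1 - e).
have dGw : dotp x.2 x.2 <= 3 * (C * dotp w (J *m w)).
  (* Lagrange's identity with |G| = 1 gives |G'|^2 = |w|^2 - (G . w)^2. *)
  rewrite -(crossp_omega x1 x12) lagrange_crossp x1 mul1r.
  have := sqr_ge0 (dotp x.1 w); rewrite -/w [dotp w w]dotpE -!expr2.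
  by have := HC w 0; have := HC w 1; have := HC w 2%:R; lra.
have := sqr_coord_le_dotp (x.1 - e) i; have := sqr_coord_le_dotp x.2 i.
move: (dotp w (J *m w)) (dotp x.2 x.2) (dotp (x.1 - e) (x.1 - e)) w0 dGw d0
  => T p D T0 pT D0 h1 h2.
(* The product contains both desired bounds; the cross terms form a nonnegative remainder. *)
have -> : (2 / k + 6 * C) * (2^-1 * T + k / 2 * D)
  = D + 3 * (C * T) + (T / k + 3 * C * k * D) by field; rewrite lt0r_neq0.
have CT0 : 0 <= C * T by rewrite mulr_ge0 // ltW.
have r0 : 0 <= T / k + 3 * C * k * D.
  by rewrite addr_ge0 ?divr_ge0 ?mulr_ge0 // ltW.
split; lra.
Qed.

Lemma energy_small : exists2 B : R, 0 < B & forall x d, tangent_sphere2 x ->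
  (forall i, `|(x.1 - e) i 0| <= d /\ `|x.2 i 0| <= d) -> W x <= B * d ^+ 2.
Proof.
have [S S0 HS] := quad_form_bound J.
set k := m * g * enorm rho; have k0 : 0 < k by rewrite !mulr_gt0 ?enorm_gt0.
(* The entries of [crossp x.2 x.1] are at most [2 * d], so half of S (2 d)^2 gives [2 * S]; [k / 2]
   times three squared coordinates gives [3 / 2 * k]. *)
exists (2 * S + 3 / 2 * k).
  by lra.
move=> x d [/sphere2_dotp x1 _] hd.
rewrite (energy_gapE x1) -/k; clearbody k.
have d0 : 0 <= d := le_trans (normr_ge0 _) (hd 0).1.
have sqd (r : R) : `|r| <= d -> r ^+ 2 <= d ^+ 2.
  by move=> rd; rewrite -(real_normK (num_real r)) lerXn2r ?nnegrE.
have D3 : dotp (x.1 - e) (x.1 - e) <= 3 * d ^+ 2.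
  rewrite dotpE -!expr2.
  have := sqd _ (hd 0).1; have := sqd _ (hd 1).1; have := sqd _ (hd 2%:R).1.
  lra.
set a := crossp x.2 x.1.
have x1i i : `|x.1 i 0| <= 1.
  have := sqr_coord_le_dotp x.1 i; rewrite x1 ler_norml => ?.
  by apply/andP; split; nra.
have a2 i : `|a i 0| <= 2 * d.
  have h j l : `|x.2 j 0 * x.1 l 0| <= d.
    by rewrite normrM -[d]mulr1 ler_pM // (hd j).2.
  rewrite mulr2n mulrDl mul1r.
  by elim/ord3_ind: i; rewrite crosspE; apply: le_trans (ler_normB _ _) _;
    apply: lerD.
(* Pythagoras for the [J]-inner product: w . J w = a . J a - b^2 (G . J G). *)
have wa : dotp (lr_omega x.1 x.2) (J *m lr_omega x.1 x.2) <= dotp a (J *m a).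
  have q0 := inertia_gt0 x1.
  rewrite /lr_omega -/a mulmxBr -scalemxAr !dotpBr !dotpBl !dotpZr !dotpZl.
  rewrite (dotp_mulmx_sym x.1 a hJ.1) (dotpC a (J *m x.1)).
  have -> : dotp (J *m x.1) a = lr_b J x.1 x.2 * dotp x.1 (J *m x.1).
    by rewrite /lr_b divfK ?lt0r_neq0.
  have := sqr_ge0 (lr_b J x.1 x.2); nra.
have := HS _ _ a2; have := ler_wpM2l (ltW k0) D3; nra.
Qed.

End Energy.

(** * Limits of vector expressions, coordinate by coordinate *)

Section CoordinatewiseLimits.
Context (R : realType) (T : Type) (F : set_system T) {FF : Filter F}.
Implicit Types (f h : T -> 'cV[R]_3) (a b : 'cV[R]_3) (A : 'M[R]_3).

(** Stated on entries so that limits of dot, cross and matrix products reduce to scalar sums and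
    products. *)
Definition col_cvg f a := forall i, (fun s => f s i 0) @ F --> a i 0.

Lemma cvg_dotp f h a b : col_cvg f a -> col_cvg h b ->
  (fun s => dotp (f s) (h s)) @ F --> dotp a b.
Proof.
move=> fa hb; rewrite dotpE.
under eq_fun do rewrite dotpE.
by apply: cvgD; [apply: cvgD|]; apply: cvgM.
Qed.

Lemma col_cvg_crossp f h a b : col_cvg f a -> col_cvg h b ->
  col_cvg (fun s => crossp (f s) (h s)) (crossp a b).
Proof.
move=> fa hb; elim/ord3_ind; rewrite crosspE;
  under eq_fun do rewrite crosspE; by apply: cvgB; apply: cvgM.
Qed.

Lemma col_cvg_mulmx A f a : col_cvg f a -> col_cvg (fun s => A *m f s) (A *m a).
Proof.
move=> fa i; rewrite mxE sum_ord3.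
under eq_fun do rewrite mxE sum_ord3.
by apply: cvgD; [apply: cvgD|]; apply: cvgM => //; exact: cvg_cst.
Qed.

Lemma col_cvgB f h a b : col_cvg f a -> col_cvg h b ->
  col_cvg (fun s => f s - h s) (a - b).
Proof.
move=> fa hb i; rewrite !mxE; under eq_fun do rewrite !mxE.
exact: cvgB.
Qed.

Lemma col_cvgZ (c : T -> R) (l : R) f a : c @ F --> l -> col_cvg f a ->
  col_cvg (fun s => c s *: f s) (l *: a).
Proof.
move=> cl fa i; rewrite !mxE; under eq_fun do rewrite !mxE.
exact: cvgM.
Qed.

End CoordinatewiseLimits.

(** * Derivatives of vector expressions along a curve *)

Section CoordinatewiseDerivatives.
Variable R : realType.
Implicit Types (f h : R -> R) (u v : R -> 'cV[R]_3) (a b : 'cV[R]_3) (t : R).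

(** The algebraic condition is linearity in the form needed to carry [phi] through a difference
    quotient; continuity then carries it through the limit. It serves for the coordinates of the
    state. *)
Lemma is_derive_linear (V : normedModType R) (phi : V -> R) (x : R -> V)
    (t : R) (dx : V) :
  continuous phi ->
  (forall (a : R) (y z : V), phi (a *: (y - z)) = a * (phi y - phi z)) ->
  is_derive t (1 : R) x dx -> is_derive t (1 : R) (phi \o x) (phi dx).
Proof.
move=> cphi lphi [xt dxt].
have phidx : (fun h : R => h^-1 *: (((phi \o x) \o shift t) (h *: 1)
    - (phi \o x) t)) @ 0^' --> phi dx.
  rewrite -dxt.
  have := cvg_comp _ _ xt (cphi ('D_1 x t)).
  by apply: cvg_trans; apply: near_eq_cvg; near=> h; rewrite /= lphi.
split; first by apply/cvg_ex; eexists; exact: phidx.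
exact: cvg_lim phidx.
Unshelve. all: by end_near. Qed.

Lemma is_derive_fun_mul f h t df dh :
  is_derive t (1 : R) f df -> is_derive t (1 : R) h dh ->
  is_derive t (1 : R) (fun s => f s * h s) (df * h t + f t * dh).
Proof.
by move=> ? ?; apply: is_derive_eq; rewrite /GRing.scale /=; ring.
Qed.

Lemma is_derive_fun_add f h t df dh :
  is_derive t (1 : R) f df -> is_derive t (1 : R) h dh ->
  is_derive t (1 : R) (fun s => f s + h s) (df + dh).
Proof. exact: is_deriveD. Qed.

Lemma is_derive_fun_sub f h t df dh :
  is_derive t (1 : R) f df -> is_derive t (1 : R) h dh ->
  is_derive t (1 : R) (fun s => f s - h s) (df - dh).
Proof. exact: is_deriveB. Qed.

Definition col_derive t u a :=
  forall i, is_derive t (1 : R) (fun s => u s i 0) (a i 0).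

Lemma is_derive_dotp t u v a b : col_derive t u a -> col_derive t v b ->
  is_derive t (1 : R) (fun s => dotp (u s) (v s)) (dotp a (v t) + dotp (u t) b).
Proof.
move=> ua vb; under eq_fun do rewrite dotpE.
apply: is_derive_eq.
  apply: is_derive_fun_add; first apply: is_derive_fun_add.
  - exact: (is_derive_fun_mul (ua 0) (vb 0)).
  - exact: (is_derive_fun_mul (ua 1) (vb 1)).
  - exact: (is_derive_fun_mul (ua 2%:R) (vb 2%:R)).
by rewrite !dotpE; ring.
Qed.

Lemma col_derive_crossp t u v a b : col_derive t u a -> col_derive t v b ->
  col_derive t (fun s => crossp (u s) (v s)) (crossp a (v t) + crossp (u t) b).
Proof.
move=> ua vb; elim/ord3_ind; rewrite mxE !crosspE;
  under eq_fun do rewrite crosspE;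
  (apply: is_derive_eq;
   [exact: is_derive_fun_sub (is_derive_fun_mul (ua _) (vb _))
                             (is_derive_fun_mul (ua _) (vb _))
   |move=> /=; ring]).
Qed.

Lemma col_derive_mulmx (A : 'M[R]_3) t u a : col_derive t u a ->
  col_derive t (fun s => A *m u s) (A *m a).
Proof.
move=> ua i; rewrite mxE sum_ord3; under eq_fun do rewrite mxE sum_ord3.
have Au j : is_derive t (1 : R) (fun s => A i j * u s j 0) (A i j * a j 0).
  by apply: is_derive_eq (is_deriveZ (A i j) (ua j)) _.
exact: is_derive_fun_add (is_derive_fun_add (Au _) (Au _)) (Au _).
Qed.

Lemma col_deriveB t u v a b : col_derive t u a -> col_derive t v b ->
  col_derive t (fun s => u s - v s) (a - b).
Proof.
move=> ua vb i; rewrite !mxE; under eq_fun do rewrite !mxE.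
exact: is_derive_fun_sub.
Qed.

Lemma col_deriveZ t f df u a : is_derive t (1 : R) f df -> col_derive t u a ->
  col_derive t (fun s => f s *: u s) (df *: u t + f t *: a).
Proof.
move=> fd ua i; rewrite !mxE; under eq_fun do rewrite !mxE.
exact: is_derive_fun_mul.
Qed.

Lemma col_derive_cst t a : col_derive t (fun=> a) 0.
Proof. by move=> i; rewrite mxE; exact: is_derive_cst. Qed.

End CoordinatewiseDerivatives.

(** * Conservation of energy along solutions *)

Section Conservation.
Variables (R : realType) (J : 'M[R]_3) (m g : R) (rho : 'cV[R]_3).
Hypothesis hJ : sym_posdef J.
Implicit Types (x : R -> 'cV[R]_3 * 'cV[R]_3) (y : 'cV[R]_3 * 'cV[R]_3).

(** The only division is by G . J G, nonzero on the sphere. Continuity is needed separately because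
    a solution is not assumed differentiable at time 0. *)
Lemma lr_energy_continuous y : tangent_sphere2 y ->
  {for y, continuous (lr_energy J m g rho)}.
Proof.
move=> [/sphere2_dotp/(inertia_gt0 hJ)/lt0r_neq0 q0 _].
have cG : col_cvg (nbhs y) fst y.1.
  move=> i; apply: (@cvg_comp _ _ _ fst (fun z : 'cV[R]_3 => z i 0)).
    exact: cvg_fst.
  exact: coord_continuous.
have cdG : col_cvg (nbhs y) snd y.2.
  move=> i; apply: (@cvg_comp _ _ _ snd (fun z : 'cV[R]_3 => z i 0)).
    exact: cvg_snd.
  exact: coord_continuous.
have cx : col_cvg (nbhs y) (fun z => crossp z.2 z.1) (crossp y.2 y.1).
  exact: col_cvg_crossp cdG cG.
have cb : (fun z => lr_b J z.1 z.2) @ y --> lr_b J y.1 y.2.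
  have cJG : col_cvg (nbhs y) (fun z => J *m z.1) (J *m y.1).
    exact: col_cvg_mulmx cG.
  exact: (cvgM (cvg_dotp cJG cx) (cvgV q0 (cvg_dotp cG cJG))).
have cw : col_cvg (nbhs y) (fun z => lr_omega J z.1 z.2) (lr_omega J y.1 y.2).
  exact: col_cvgB cx (col_cvgZ cb cG).
have cJw : col_cvg (nbhs y) (fun z => J *m lr_omega J z.1 z.2)
    (J *m lr_omega J y.1 y.2).
  exact: col_cvg_mulmx cw.
have cr : col_cvg (nbhs y) (fun=> rho) rho by move=> i; exact: cvg_cst.
exact: (cvgB (cvgM (cvg_cst _) (cvg_dotp cw cJw))
             (cvgM (cvg_cst _) (cvg_dotp cr cG))).
Qed.

(** By symmetry of [J] the kinetic term has derivative (J w) . w', which [kinetic_power] equates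
    with m g rho . G', the rate subtracted by the potential term. *)
Lemma lr_energy_derive x t : tangent_sphere2 (x t) ->
  is_derive t (1 : R) x (lr_field J m g rho 0 (x t)) ->
  is_derive t (1 : R) (lr_energy J m g rho \o x) 0.
Proof.
move=> [/sphere2_dotp x1 x12] dx.
have dG : col_derive t (fun s => (x s).1) (x t).2.
  move=> i; pose phi (z : 'cV[R]_3 * 'cV[R]_3) : R := z.1 i 0.
  apply: (is_derive_linear (phi := phi) _ _ dx).
    move=> z; apply: (@cvg_comp _ _ _ fst (fun z : 'cV[R]_3 => z i 0)).
      exact: cvg_fst.
    exact: coord_continuous.
  by move=> a y z; rewrite /phi !mxE.
have ddG : col_derive t (fun s => (x s).2) (lr_field J m g rho 0 (x t)).2.
  move=> i; pose phi (z : 'cV[R]_3 * 'cV[R]_3) : R := z.2 i 0.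
  apply: (is_derive_linear (phi := phi) _ _ dx).
    move=> z; apply: (@cvg_comp _ _ _ snd (fun z : 'cV[R]_3 => z i 0)).
      exact: cvg_snd.
    exact: coord_continuous.
  by move=> a y z; rewrite /phi !mxE.
have dJG := col_derive_mulmx J dG.
have dc := col_derive_crossp ddG dG.
(* Existence suffices, since [kinetic_power] holds for every [b']. *)
have [b' db] : exists b',
    is_derive t (1 : R) (fun s => lr_b J (x s).1 (x s).2) b'.
  eexists; apply: is_derive_fun_mul; first exact: is_derive_dotp dJG dc.
  apply: is_deriveV; last exact: is_derive_dotp dG dJG.
  exact/lt0r_neq0/inertia_gt0.
have dw := col_deriveB dc (col_deriveZ db dG).
have dK := is_derive_dotp dw (col_derive_mulmx J dw).
have dP := is_derive_dotp (col_derive_cst t rho) dG.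
have dE := is_derive_fun_sub
  (is_derive_fun_mul (is_derive_cst (2^-1 : R) t (1 : R)) dK)
  (is_derive_fun_mul (is_derive_cst (m * g : R) t (1 : R)) dP).
apply: is_derive_eq dE _.
(* The product rule for G' x G produces an extra G' x G', which is zero. *)
rewrite crossp_id addr0 -/(lr_omega J (x t).1 (x t).2).
have := kinetic_power m g rho hJ b' x1 x12.
rewrite -surjective_pairing.
set w := lr_omega _ _ _; set dw' := _ - _ => P.
rewrite (dotpC dw') (dotp_mulmx_sym w dw' hJ.1) P.
by rewrite [dotp 0 _]dotpE !mxE /cst; field.
Qed.

Lemma lr_energy_conserved (T : \bar R) x :
  is_solution (@tangent_sphere2 R) (lr_field J m g rho 0) T x ->
  forall t, 0 <= t -> (t%:E < T)%E ->
  lr_energy J m g rho (x t) = lr_energy J m g rho (x 0).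
Proof.
move=> [cx Mx dx] t t0 tT; apply/eqP; rewrite -subr_eq0; apply/eqP.
have lt s : s <= t -> (s%:E < T)%E.
  by move=> st; apply: le_lt_trans tT; rewrite lee_fin.
(* The mean value theorem uses derivatives only at interior times, and continuity on the closed
   segment covers time 0. *)
have [] := @MVT_segment R (lr_energy J m g rho \o x) (fun=> 0) 0 t t0.
- move=> s; rewrite in_itv /= => /andP[s0 st].
  by apply: lr_energy_derive; [apply: Mx|apply: dx] => //; rewrite ?lt // ltW.
- apply: within_continuous_comp.
    move=> y; rewrite inE => -[s /=]; rewrite in_itv /= => /andP[s0 st] <-.
    by apply: lr_energy_continuous; apply: Mx => //; exact: lt.
  apply: continuous_subspaceW cx => s /=; rewrite in_itv /= => /andP[s0 st].
  by split => //; exact: lt.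
- by move=> c _ /= ->; rewrite mul0r.
Qed.

End Conservation.

(** * Comparison of coordinates with the sup norm *)

Section SupNorm.
Variable R : realType.
Implicit Type u : 'cV[R]_3.

Lemma coord_le_norm u i : `|u i 0| <= `|u|.
Proof.
rewrite [leRHS]/Num.norm /= mx_normrE.
exact: (le_bigmax _ (fun ij => `|u ij.1 ij.2|) (i, 0)).
Qed.

Lemma norm_lt_coord u e : 0 < e -> (forall i, `|u i 0| < e) -> `|u| < e.
Proof.
move=> e0 ue; rewrite [ltLHS]/Num.norm /= mx_normrE.
by apply: bigmax_lt => // -[i j] _; rewrite (ord1 j).
Qed.

End SupNorm.

(** * Equilibrium and stability of the hanging state *)

Section HangingStable.
Variables (R : realType) (J : 'M[R]_3) (m g : R) (rho : 'cV[R]_3).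
Hypotheses (hJ : sym_posdef J) (hm : 0 < m) (hg : 0 < g) (hrho : rho != 0).

Let e := (enorm rho)^-1 *: rho.

Lemma hanging_equilibrium :
  is_equilibrium (@tangent_sphere2 R) (lr_field J m g rho 0) (e, 0).
Proof.
have ee := hanging_dotp hrho.
have dot0 (u : 'cV[R]_3) : dotp u 0 = 0 by rewrite dotpE !mxE; ring.
have cross0 (u : 'cV[R]_3) : crossp u 0 = 0.
  by rewrite -(scale0r u) crosspZr !scale0r.
have cross0l (u : 'cV[R]_3) : crossp 0 u = 0.
  by rewrite crossp_anti cross0 oppr0.
split.
  split=> /=; last exact: dot0.
  by rewrite /sphere2 /= /enorm ee sqrtr1.
(* Gravity exerts no torque, [e] being parallel to [rho]; the other terms of [lr_Sigma] vanish with
   the velocity and the momentum. *)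
have er : crossp e rho = 0 by rewrite /e crosspZl crossp_id scaler0.
rewrite /lr_field /=; congr (_, _).
rewrite enorm_sqr dot0 oppr0 scale0r add0r /lr_Sigma.
rewrite /lr_b /lr_nu cross0l dot0 !mul0r expr0n !scale0r mulmx0 subr0.
by rewrite !cross0 er !scaler0 !(subr0, addr0) mulmx0 addr0 cross0.
Qed.

(** Coercivity at time [t], conservation, and the upper bound at time 0 are chained. [K] depends
    neither on the solution nor on its lifetime. *)
Lemma hanging_growth : exists2 K : R, 0 < K &
  forall (T : \bar R) (x : R -> 'cV[R]_3 * 'cV[R]_3), (0 < T)%E ->
    is_solution (@tangent_sphere2 R) (lr_field J m g rho 0) T x ->
  forall t, 0 <= t -> (t%:E < T)%E -> forall i,
    ((x t).1 - e) i 0 ^+ 2 <= K * `|x 0 - (e, 0)| ^+ 2 /\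
    (x t).2 i 0 ^+ 2 <= K * `|x 0 - (e, 0)| ^+ 2.
Proof.
have [A A0 HA] := energy_coercive hJ hm hg hrho.
have [B B0 HB] := energy_small hJ hm hg hrho.
exists (A * B); first exact: mulr_gt0.
move=> T x T0 sx t t0 tT i; have [_ Mx _] := sx.
have [h1 h2] := HA _ (Mx t t0 tT) i.
rewrite (lr_energy_conserved hJ sx t0 tT) in h1 h2.
have /(HB _ _ (Mx 0 (lexx 0) T0)) h0 : forall j,
    `|((x 0).1 - e) j 0| <= `|x 0 - (e, 0)| /\
    `|(x 0).2 j 0| <= `|x 0 - (e, 0)|.
  move=> j; split; apply: le_trans (coord_le_norm _ _) _.
    by rewrite [leRHS]/Num.norm /= le_max lexx.
  have -> : (x 0).2 = (x 0 - (e, 0)).2 by rewrite /= subr0.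
  by rewrite [leRHS]/Num.norm /= le_max lexx orbT.
have {}h0 := ler_wpM2l (ltW A0) h0; rewrite mulrA in h0.
by split; [apply: le_trans h1 h0|apply: le_trans h2 h0].
Qed.

Lemma hanging_lyapunov_stable :
  lyapunov_stable (@tangent_sphere2 R) (lr_field J m g rho 0) (e, 0).
Proof.
split; first exact: hanging_equilibrium.
have [K K0 HK] := hanging_growth.
(* Since K <= (1 + K)^2, this radius forces K d^2 < eps^2 for an initial deviation d, with no square
   root of [K]. *)
move=> eps eps0; exists (eps / (1 + K)); first by rewrite divr_gt0 ?addr_gt0.
move=> T x T0 sx x0 t t0 tT.
have small (r : R) : r ^+ 2 <= K * `|x 0 - (e, 0)| ^+ 2 -> `|r| < eps.
  move: `|_ - _| (normr_ge0 (x 0 - (e, 0))) x0 => d d0.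
  rewrite ltr_pdivlMr ?addr_gt0 // => dK rd.
  rewrite ltr_norml; apply/andP.
  have : r ^+ 2 < eps ^+ 2.
    have : (d * (1 + K)) ^+ 2 < eps ^+ 2.
      by rewrite ltrXn2r ?nnegrE // ?mulr_ge0 // ?addr_ge0 // ltW.
    have := mulr_ge0 (ltW K0) (sqr_ge0 d).
    have := sqr_ge0 d; have := sqr_ge0 (d * K).
    by nra.
  by split; nra.
have H := HK T x T0 sx t t0 tT.
(* The norm of a pair is the maximum of two sup norms, so bounds on single coordinates suffice. *)
rewrite [ltLHS]/Num.norm /= gt_max !norm_lt_coord //= => i; apply: small.
- by rewrite subr0 (H i).2.
- exact: (H i).1.
Qed.

End HangingStable.

Theorem proposition22 (R : realType) (J : 'M[R]_3) (m g : R)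
    (rho : 'cV[R]_3) (mu : R)
    (hJ : sym_posdef J) (hm : 0 < m) (hg : 0 < g) (hrho : rho != 0)
    (hmu : mu = 0) :
  lyapunov_stable (@tangent_sphere2 R) (lr_field J m g rho mu)
    ((enorm rho)^-1 *: rho, 0).
Proof. by rewrite hmu; exact: hanging_lyapunov_stable. Qed.
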